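(* Let $f(z)=z^{p}+\sum_{k=n}^{\infty}a_{k+p}z^{k+p}$ and $g(z)=z^{p}+\sum_{k=n}^{\infty}b_{k+p}z^{k+p}$ belong to $\mathcal{F}(\lambda,m,\Omega)$, where $p>m$. Suppose $f\in(\alpha,\beta,\lambda,m,\delta,\Omega)_{p}\text{-}N(g)$ with $0\le\alpha<\beta\le\pi$, and suppose there is a real number $\phi$ such that $\arg(e^{i\alpha}a_{k+p}-e^{i\beta}b_{k+p})=k\phi$ for all $k\ge n$. Then $$\sum_{k=n}^{\infty}\frac{(k+p-m)^{\Omega+1}(k+p)!\,(1+\lambda k(p-m)^{-1})}{(p-m)^{\Omega}(k+p-m)!}\left|e^{i\alpha}a_{k+p}-e^{i\beta}b_{k+p}\right|\le\delta-\frac{p!}{(p-m-1)!}(\cos\alpha-\cos\beta).$$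
   Context: Let $\mathcal{U}=\{z\in\mathbb{C}:|z|<1\}$, $\mathbb{N}=\{1,2,3,\dots\}$, $\mathbb{N}_0=\mathbb{N}\cup\{0\}$. Throughout $n,p\in\mathbb{N}$, $m,\Omega\in\mathbb{N}_0$, $p>m$, $0\le\lambda\le1$, and the coefficients are complex. For $f(z)=z^{p}+\sum_{k=n}^{\infty}a_{k+p}z^{k+p}$ analytic in $\mathcal{U}$, $f^{(m)}$ is its $m$-th derivative. The (Salagean type) operator is $D^{0}f^{(m)}(z)=f^{(m)}(z)$, $D^{1}f^{(m)}(z)=\frac{z}{p-m}(f^{(m)}(z))'$, $D^{\Omega}f^{(m)}=D(D^{\Omega-1}f^{(m)})$. Define $$\mathcal{F}(f^{(m)}(z))=(1-\lambda)D^{\Omega}f^{(m)}(z)+\frac{\lambda z}{p-m}\left(D^{\Omega}f^{(m)}(z)\right)'=\frac{p!}{(p-m)!}z^{p-m}+\sum_{k=n}^{\infty}\frac{(k+p)!(k+p-m)^{\Omega}(1+\lambda k(p-m)^{-1})}{(p-m)^{\Omega}(k+p-m)!}a_{k+p}z^{k+p-m}.$$ ''$f\in\mathcal{F}(\lambda,m,\Omega)$'' means that $f(z)=z^{p}+\sum_{k\ge n}a_{k+p}z^{k+p}$ has coefficients such that this last function is analytic in $\mathcal{U}$ (equivalently, $f$ is analytic in $\mathcal{U}$). $\mathcal{F}'(f^{(m)}(z))$ denotes the derivative with respect to $z$ of $\mathcal{F}(f^{(m)}(z))$; quotients by powers of $z$ are understood at $z=0$ by removing the singularity. For $f,g\in\mathcal{F}(\lambda,m,\Omega)$,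 real $\alpha,\beta$ with $-\pi\le\alpha-\beta\le\pi$, and $\delta>\frac{p!}{(p-m-1)!}\sqrt{2[1-\cos(\alpha-\beta)]}$, one writes $f\in(\alpha,\beta,\lambda,m,\delta,\Omega)_p\text{-}N(g)$ if $$\left|\frac{e^{i\alpha}\mathcal{F}'(f^{(m)}(z))}{z^{p-m-1}}-\frac{e^{i\beta}\mathcal{F}'(g^{(m)}(z))}{z^{p-m-1}}\right|<\delta\qquad(z\in\mathcal{U}).$$ The condition $\arg(w_k)=k\phi$ is understood modulo $2\pi$, i.e. $w_k=|w_k|e^{ik\phi}$ (no condition when $w_k=0$). *)

(* Defs.v *)
From Stdlib Require Import Reals Factorial.
From Coquelicot Require Import Coquelicot.
Open Scope R_scope.

Definition in_disk (z : C) : Prop := Cmod z < 1.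

Definition analytic_in_disk (h : C -> C) : Prop :=
  forall z : C, in_disk z -> @ex_derive C_AbsRing C_NormedModule h z.

(* exp (i t) *)
Definition expi (t : R) : C := (cos t, sin t).

(* t is a value of arg w modulo 2 pi; no condition when w = 0. *)
Definition has_arg (w : C) (t : R) : Prop := w = (Cmod w * expi t)%C.

(* C_derive is a total operator: it is the complex derivative wherever that
   exists, in particular on the disk for functions analytic there. *)
Definition C_derive_n (m : nat) (f : C -> C) : C -> C := Nat.iter m C_derive f.

(* Here and below p - m is a truncated subtraction; it is only used
   for m < p. *)
Definition Dop (p m : nat) (h : C -> C) : C -> C :=
  fun z => (z / INR (p - m) * C_derive h z)%C.

(* D^Omega f^(m) *)
Definition salagean (p m Omega : nat) (f : C -> C) : C -> C :=
  Nat.iter Omega (Dop p m) (C_derive_n m f).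

(* z |-> F(f^(m)(z)) *)
Definition calF (p : nat) (lambda : R) (m Omega : nat) (f : C -> C) : C -> C :=
  fun z =>
    ((1 - lambda) * salagean p m Omega f z
     + lambda * z / INR (p - m) * C_derive (salagean p m Omega f) z)%C.

(* f(z) = z^p + sum_(k >= n) a_(k+p) z^(k+p) on the disk, with k = n + j;
   the entries of a of index below n + p are irrelevant. *)
Definition has_expansion (n p : nat) (a : nat -> C) (f : C -> C) : Prop :=
  forall z : C, in_disk z ->
    @is_series C_AbsRing C_NormedModule
      (fun j : nat => (a (n + j + p)%nat * z ^ (n + j + p))%C)
      (f z - z ^ p)%C.

(* f, with coefficients a, belongs to the class F(lambda, m, Omega). *)
Definition class_F (n p : nat) (lambda : R) (m Omega : nat)
    (a : nat -> C) (f : C -> C) : Prop :=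
  has_expansion n p a f /\ analytic_in_disk (calF p lambda m Omega f).

(* h(z) / z^q, with the value at 0 obtained by removing the singularity. *)
Definition div_pow (h : C -> C) (q : nat) (z : C) : C :=
  if Ceq_dec z 0 then C_lim (fun w : C => (h w / w ^ q)%C) 0
  else (h z / z ^ q)%C.

(* f in (alpha, beta, lambda, m, delta, Omega)_p - N(g), including the
   restrictions on alpha, beta, delta under which this notation is used. *)
Definition in_nbhd (alpha beta lambda : R) (m : nat) (delta : R)
    (Omega p : nat) (g f : C -> C) : Prop :=
  - PI <= alpha - beta <= PI /\
  delta > INR (fact p) / INR (fact (p - m - 1))
          * sqrt (2 * (1 - cos (alpha - beta))) /\
  forall z : C, in_disk z ->
    Cmod (expi alpha
            * div_pow (C_derive (calF p lambda m Omega f)) (p - m - 1) z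
          - expi beta
            * div_pow (C_derive (calF p lambda m Omega g)) (p - m - 1) z)%C
    < delta.

(* a_(k+p) times this is the coefficient of z^k in F'(f^(m)(z)) / z^(p-m-1). *)
Definition coefF (p : nat) (lambda : R) (m Omega k : nat) : R :=
  INR (k + p - m) ^ (Omega + 1) * INR (fact (k + p))
    * (1 + lambda * INR k / INR (p - m))
  / (INR (p - m) ^ Omega * INR (fact (k + p - m))).

(* Main.v *)
(** Differentiating power series termwise inside the unit disk gives
    F'(f^(m)(z)) / z^(p-m-1) = sum_j coefF_j a_(j+p) z^j, where a_p = 1 and
    a_(j+p) = 0 for 0 < j < n. At z = r e^(-i phi) the argument condition makes
    every term of
    e^(i alpha) F'(f^(m)(z)) / z^(p-m-1) - e^(i beta) F'(g^(m)(z)) / z^(p-m-1)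
    past the constant one equal to the nonnegative real number
    coefF_j |e^(i alpha) a_(j+p) - e^(i beta) b_(j+p)| r^j. The real part of
    the whole sum is less than delta; letting r tend to 1 gives the bound. *)
Require Import Defs.
From Stdlib Require Import Reals Factorial Lra Lia.
From Coquelicot Require Import Coquelicot.
Open Scope R_scope.

(** * Complex power series on the unit disk: norm bounds and absolute convergence *)

Notation is_Cseries := (@is_series C_AbsRing C_NormedModule).

Definition has_power_series (c : nat -> C) (h : C -> C) : Prop :=
  forall z : C, in_disk z -> is_Cseries (fun k => c k * z ^ k)%C (h z).

Lemma has_power_series_ext (c d : nat -> C) (h : C -> C) :
  (forall k, c k = d k) -> has_power_series c h -> has_power_series d h.
Proof.
  intros e H z hz.
  apply is_series_ext with (2 := H z hz).
  intros k; now rewrite e.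
Qed.

Lemma Cseries_eq (a b : nat -> C) (l l' : C) :
  (forall k, a k = b k) -> l = l' -> is_Cseries a l -> is_Cseries b l'.
Proof. intros e <-; now apply is_series_ext. Qed.

Lemma ex_Cseries_of_abs (a : nat -> C) :
  ex_series (fun k => Cmod (a k)) -> exists l : C, is_Cseries a l.
Proof.
  intros H.
  apply (@ex_series_le C_AbsRing C_CompleteNormedModule a _) with (2 := H).
  intros k; apply Rle_refl.
Qed.

Lemma Cseries_norm_le (a : nat -> C) (b : nat -> R) (l : C) (B : R) :
  (forall k, Cmod (a k) <= b k) -> is_Cseries a l -> is_series b B ->
  Cmod l <= B.
Proof.
  intros hab ha hb.
  apply (@filterlim_le nat eventually _
    (fun N => Cmod (@sum_n C_NormedModule a N)) (fun N => sum_n b N)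
    (Cmod l) B).
  - apply filter_forall; intros N.
    eapply Rle_trans; [exact (@norm_sum_n_m C_AbsRing C_NormedModule a 0 N)|].
    apply sum_n_m_le; exact hab.
  - eapply filterlim_comp; [exact ha|].
    exact (@filterlim_norm C_AbsRing C_NormedModule l).
  - exact hb.
Qed.

(** Convergence at a real point [s] strictly between [r] and 1 bounds the terms
    [Cmod (c k) * s ^ k], so the series at radius [r] is dominated by a geometric one of ratio
    [r / s]. *)
Lemma power_series_abs (c : nat -> C) (h : C -> C) (r : R) :
  has_power_series c h -> 0 <= r < 1 ->
  ex_series (fun k => Cmod (c k) * r ^ k).
Proof.
  intros H hr.
  set (s := (r + 1) / 2).
  assert (hs : r < s < 1) by (unfold s; lra).
  assert (hz : in_disk (RtoC s)).
  { unfold in_disk; rewrite Cmod_R, Rabs_pos_eq; lra. }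
  destruct (@filterlim_bounded C_AbsRing C_NormedModule _
    (ex_intro _ _ (H _ hz))) as [M hM].
  assert (hM0 : 0 <= M).
  { eapply Rle_trans; [|apply (hM 0%nat)]; apply norm_ge_0. }
  (* Each term is the difference of two consecutive partial sums, and the partial sums are bounded
     by [M] because they converge. *)
  assert (hb : forall k, Cmod (c k) * s ^ k <= 2 * M).
  { intros k.
    assert (e : Cmod (c k) * s ^ k = Cmod (c k * RtoC s ^ k)%C).
    { rewrite Cmod_mult, Cmod_pow, Cmod_R, Rabs_pos_eq; lra. }
    rewrite e.
    destruct k as [|k].
    - generalize (hM 0%nat); rewrite sum_O; intros h0.
      change (Cmod (c O * RtoC s ^ O)%C <= M) in h0; lra.
    - pose proof (hM (S k)) as h1; pose proof (hM k) as h2.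
      rewrite sum_Sn in h1.
      change (Cmod (@sum_n C_NormedModule (fun k => c k * RtoC s ^ k)%C k
        + c (S k) * RtoC s ^ S k)%C <= M) in h1.
      change (Cmod (@sum_n C_NormedModule (fun k => c k * RtoC s ^ k)%C k)
        <= M) in h2.
      set (S0 := @sum_n C_NormedModule (fun k => c k * RtoC s ^ k)%C k) in *.
      set (t := (c (S k) * RtoC s ^ S k)%C) in *.
      replace t with ((S0 + t) + - S0)%C by ring.
      eapply Rle_trans; [apply Cmod_triangle|].
      rewrite Cmod_opp; lra. }
  apply (@ex_series_le R_AbsRing R_CompleteNormedModule _
    (fun k => (2 * M) * (r / s) ^ k)).
  - intros k; change (Rabs (Cmod (c k) * r ^ k) <= 2 * M * (r / s) ^ k).
    rewrite Rabs_pos_eq.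
    2:{ apply Rmult_le_pos; [apply Cmod_ge_0 | apply pow_le; lra]. }
    replace (Cmod (c k) * r ^ k) with (Cmod (c k) * s ^ k * (r / s) ^ k).
    + apply Rmult_le_compat_r; [|apply hb].
      apply pow_le, Rdiv_le_0_compat; lra.
    + rewrite Rmult_assoc, <- Rpow_mult_distr.
      do 2 f_equal; field; lra.
  - apply (@ex_series_scal_l R_AbsRing R_NormedModule (2 * M)).
    apply ex_series_geom.
    assert (h0 : 0 <= r / s) by (apply Rdiv_le_0_compat; lra).
    rewrite Rabs_pos_eq by exact h0.
    apply Rmult_lt_reg_r with s; [lra|].
    unfold Rdiv; rewrite Rmult_assoc, Rinv_l; lra.
Qed.

(** * Termwise differentiation *)

(* Both sides obey the recurrence E_(k+1) = w E_k + k z^(k-1) (w - z)^2, the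
   right one with |z| + e and |z| in place of w and z. *)
Lemma pow_remainder_le (z w : C) (e : R) (k : nat) :
  0 < e -> Cmod (w - z) <= e ->
  Cmod (w ^ k - z ^ k - INR k * z ^ pred k * (w - z))
  <= Cmod (w - z) ^ 2 / e ^ 2
     * ((Cmod z + e) ^ k - Cmod z ^ k - INR k * Cmod z ^ pred k * e).
Proof.
  intros he hw.
  assert (hws : Cmod w <= Cmod z + e).
  { replace w with (z + (w - z))%C by ring.
    eapply Rle_trans; [apply Cmod_triangle|lra]. }
  assert (hsucc : forall j, RtoC (INR (S j)) = (RtoC (INR j) + 1)%C).
  { intros j; rewrite S_INR, RtoC_plus; reflexivity. }
  induction k as [|k IH].
  - simpl (INR 0); simpl.
    replace (1 - 1 - 0 * 1 * (w - z))%C with (RtoC 0) by ring.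
    rewrite Cmod_0; apply Req_le; ring.
  - assert (e1 : (w ^ S k - z ^ S k - INR (S k) * z ^ pred (S k) * (w - z)
      = w * (w ^ k - z ^ k - INR k * z ^ pred k * (w - z))
        + INR k * z ^ pred k * (w - z) ^ 2)%C).
    (* The case split resolves [pred k]; at [k = 0] the factor [INR k] removes the last term. *)
    { rewrite hsucc; destruct k as [|k]; [simpl; ring|].
      rewrite hsucc; simpl; ring. }
    assert (e2 : (Cmod z + e) ^ S k - Cmod z ^ S k
        - INR (S k) * Cmod z ^ pred (S k) * e
      = (Cmod z + e) * ((Cmod z + e) ^ k - Cmod z ^ k
          - INR k * Cmod z ^ pred k * e)
        + INR k * Cmod z ^ pred k * e ^ 2).
    { rewrite S_INR; destruct k as [|k]; [simpl; ring|].
      rewrite S_INR; simpl; ring. }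
    rewrite e1, e2.
    eapply Rle_trans; [apply Cmod_triangle|].
    rewrite !Cmod_mult, !Cmod_pow, Cmod_R, Rabs_pos_eq by apply pos_INR.
    rewrite Rmult_plus_distr_l; apply Rplus_le_compat.
    + eapply Rle_trans.
      * apply Rmult_le_compat; [apply Cmod_ge_0..|exact hws|exact IH].
      * apply Req_le; ring.
    + apply Req_le; field; lra.
Qed.

Lemma in_disk_margin (z : C) : in_disk z ->
  exists e, 0 < e /\ Cmod z + e < 1.
Proof.
  intros hz; exists ((1 - Cmod z) / 2); unfold in_disk in hz; lra.
Qed.

(** The left side is the linear term in [e] of the binomial expansion of [(s + e) ^ k]. The
    induction carries the constant term [s ^ k] along; multiplying by [s + e] overshoots the next
    two terms by the nonnegative [INR k * s ^ pred k * e * e]. *)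
Lemma pow_derive_le (s e : R) (k : nat) :
  0 <= s -> 0 < e -> INR k * s ^ pred k * e <= (s + e) ^ k.
Proof.
  intros hs he.
  enough (s ^ k + INR k * s ^ pred k * e <= (s + e) ^ k)
    by (pose proof (pow_le s k hs); lra).
  induction k as [|k IH]; [simpl; lra|].
  assert (h : 0 <= INR k * s ^ pred k * e * e).
  { repeat apply Rmult_le_pos; try lra; [apply pos_INR|now apply pow_le]. }
  replace (s ^ S k + INR (S k) * s ^ pred (S k) * e)
    with ((s + e) * (s ^ k + INR k * s ^ pred k * e)
          - INR k * s ^ pred k * e * e).
  - apply Rle_trans with ((s + e) * (s ^ k + INR k * s ^ pred k * e)); [lra|].
    simpl pow; apply Rmult_le_compat_l; lra.
  - rewrite S_INR; destruct k as [|k]; simpl; ring.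
Qed.

(** With [B] the sum of [Cmod (c k) * (Cmod z + e) ^ k], summing [pow_remainder_le] over all terms
    bounds the error of the linear approximation at [z] by [B / e ^ 2 * Cmod (w - z) ^ 2]. A
    quadratic error gives differentiability with no interchange of limits. *)
Lemma power_series_derivable (c : nat -> C) (h : C -> C) (z : C) :
  has_power_series c h -> in_disk z ->
  exists l : C, is_Cseries (fun k => c k * (INR k * z ^ pred k))%C l /\
    @is_derive C_AbsRing C_NormedModule h z l.
Proof.
  intros H hz.
  destruct (in_disk_margin z hz) as [e [he hze]].
  pose proof (Cmod_ge_0 z) as hz0.
  assert (habs := power_series_abs c h (Cmod z + e) H
    (conj (Rplus_le_le_0_compat _ _ hz0 (Rlt_le _ _ he)) hze)).
  destruct (ex_Cseries_of_abs (fun k => c k * (INR k * z ^ pred k))%C)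
    as [l hl].
  { apply (@ex_series_le R_AbsRing R_CompleteNormedModule _
      (fun k => / e * (Cmod (c k) * (Cmod z + e) ^ k))).
    2: now apply (@ex_series_scal_l R_AbsRing R_NormedModule (/ e)).
    intros k.
    change (Rabs (Cmod (c k * (INR k * z ^ pred k))%C)
      <= / e * (Cmod (c k) * (Cmod z + e) ^ k)).
    rewrite Rabs_pos_eq by apply Cmod_ge_0.
    rewrite !Cmod_mult, Cmod_pow, Cmod_R, Rabs_pos_eq by apply pos_INR.
    replace (Cmod (c k) * (INR k * Cmod z ^ pred k))
      with (/ e * (Cmod (c k) * (INR k * Cmod z ^ pred k * e)))
      by (field; lra).
    apply Rmult_le_compat_l; [left; now apply Rinv_0_lt_compat|].
    apply Rmult_le_compat_l; [apply Cmod_ge_0|now apply pow_derive_le]. }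
  exists l; split; [exact hl|].
  destruct habs as [B hB].
  (* [B] dominates the modulus of [h z]. *)
  assert (hB0 : 0 <= B).
  { apply Rle_trans with (Cmod (h z)); [apply Cmod_ge_0|].
    refine (Cseries_norm_le _ _ _ _ _ (H z hz) hB).
    intros k; rewrite Cmod_mult, Cmod_pow.
    apply Rmult_le_compat_l; [apply Cmod_ge_0|apply pow_incr; lra]. }
  assert (hrem : forall w, Cmod (w - z) <= e ->
    Cmod (h w - h z - (w - z) * l) <= B / e ^ 2 * Cmod (w - z) ^ 2).
  { intros w hw.
    assert (hwd : in_disk w).
    { unfold in_disk; replace w with (z + (w - z))%C by ring.
      eapply Rle_lt_trans; [apply Cmod_triangle|lra]. }
    apply (Cseries_norm_le
      (fun k => c k * (w ^ k - z ^ k - INR k * z ^ pred k * (w - z)))%C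
      (fun k => Cmod (w - z) ^ 2 / e ^ 2 * (Cmod (c k) * (Cmod z + e) ^ k))).
    - intros k; rewrite Cmod_mult.
      apply Rle_trans with (Cmod (c k) *
        (Cmod (w - z) ^ 2 / e ^ 2 * (Cmod z + e) ^ k)).
      2: apply Req_le; ring.
      apply Rmult_le_compat_l; [apply Cmod_ge_0|].
      eapply Rle_trans; [exact (pow_remainder_le z w e k he hw)|].
      apply Rmult_le_compat_l.
      { apply Rdiv_le_0_compat; [apply pow2_ge_0|now apply pow_lt]. }
      (* The two quantities subtracted in the remainder bound are nonnegative, so only
         [(Cmod z + e) ^ k] is kept. *)
      assert (0 <= INR k * Cmod z ^ pred k * e).
      { repeat apply Rmult_le_pos; try lra; [apply pos_INR|now apply pow_le]. }
      pose proof (pow_le (Cmod z) k hz0); lra.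
    - eapply Cseries_eq;
        [| |exact (is_series_minus _ _ _ _
              (is_series_minus _ _ _ _ (H w hwd) (H z hz))
              (is_series_scal_l (w - z)%C _ _ hl))].
      + intros k.
        change ((c k * w ^ k + - (c k * z ^ k)
          + - ((w - z) * (c k * (INR k * z ^ pred k))))%C
          = (c k * (w ^ k - z ^ k - INR k * z ^ pred k * (w - z)))%C).
        ring.
      + reflexivity.
    - replace (B / e ^ 2 * Cmod (w - z) ^ 2)
        with (Cmod (w - z) ^ 2 / e ^ 2 * B) by (field; lra).
      exact (is_series_scal_l (K := R_AbsRing) (V := R_NormedModule)
        (Cmod (w - z) ^ 2 / e ^ 2) _ _ hB). }
  split; [apply is_linear_scal_l|].
  intros x hx.
  apply (is_filter_lim_locally_unique
    (V := AbsRing_NormedModule C_AbsRing)) in hx; subst x.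
  intros eps.
  (* The added 1 keeps [K] positive even when [B = 0], so that [eps / K] is a legitimate radius; the
     minimum with [e] keeps [w] where [hrem] applies. *)
  set (K := B / e ^ 2 + 1).
  assert (hK : 0 < K).
  { unfold K; assert (0 <= B / e ^ 2); [|lra].
    apply Rdiv_le_0_compat; [exact hB0|now apply pow_lt]. }
  assert (hd : 0 < Rmin e (eps / K)).
  { apply Rmin_pos; [exact he|apply Rdiv_lt_0_compat; [apply cond_pos|lra]]. }
  apply filter_imp with (2 := locally_ball_norm
    (V := AbsRing_NormedModule C_AbsRing) z (mkposreal _ hd)).
  intros w hw.
  change (Cmod (w - z) < Rmin e (eps / K)) in hw.
  change (Cmod (h w - h z - (w - z) * l) <= eps * Cmod (w - z)).
  pose proof (Rmin_l e (eps / K)); pose proof (Rmin_r e (eps / K)).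
  eapply Rle_trans; [apply hrem; lra|].
  pose proof (Cmod_ge_0 (w - z)) as h0.
  replace (B / e ^ 2 * Cmod (w - z) ^ 2)
    with (B / e ^ 2 * Cmod (w - z) * Cmod (w - z)) by ring.
  apply Rmult_le_compat_r; [exact h0|].
  apply Rle_trans with (K * Cmod (w - z)).
  - apply Rmult_le_compat_r; [exact h0|unfold K; lra].
  - apply Rle_trans with (K * (eps / K)).
    + apply Rmult_le_compat_l; lra.
    + apply Req_le; field; lra.
Qed.

(** * Action of the differential operators on coefficients *)

(** Uniqueness of the derivative identifies the total operator [C_derive] with the termwise sum; the
    term of index 0 vanishes, which allows the shift of index. *)
Lemma power_series_derive (c : nat -> C) (h : C -> C) :
  has_power_series c h ->
  has_power_series (fun k => INR (S k) * c (S k))%C (C_derive h).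
Proof.
  intros H z hz.
  destruct (power_series_derivable c h z H hz) as [l [hl hd]].
  rewrite (is_C_derive_unique _ _ _ hd).
  eapply Cseries_eq; [|reflexivity|apply is_series_incr_1].
  2:{ eapply Cseries_eq; [| |exact hl]; [reflexivity|].
      change (l = l + c O * (INR 0 * z ^ pred 0) :> C)%C; simpl; ring. }
  intros k; simpl; ring.
Qed.

Lemma power_series_scal_plus (u v : C) (c d : nat -> C) (h1 h2 : C -> C) :
  has_power_series c h1 -> has_power_series d h2 ->
  has_power_series (fun k => u * c k + v * d k)%C
    (fun z => u * h1 z + v * h2 z)%C.
Proof.
  intros H1 H2 z hz.
  eapply Cseries_eq; [| |exact (is_series_plus _ _ _ _
    (is_series_scal_l u _ _ (H1 z hz)) (is_series_scal_l v _ _ (H2 z hz)))].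
  - intros k.
    change (u * (c k * z ^ k) + v * (d k * z ^ k)
      = (u * c k + v * d k) * z ^ k)%C; ring.
  - reflexivity.
Qed.

(** The factor [z] undoes the index shift of differentiation, and the constant term that reappears
    has coefficient 0. *)
Lemma power_series_euler (c : nat -> C) (h : C -> C) :
  has_power_series c h ->
  has_power_series (fun k => INR k * c k)%C (fun z => z * C_derive h z)%C.
Proof.
  intros H z hz.
  apply (@is_series_decr_1 C_AbsRing C_NormedModule).
  eapply Cseries_eq; [| |exact (is_series_scal_l z _ _
    (power_series_derive c h H z hz))].
  - intros k.
    change (z * (INR (S k) * c (S k) * z ^ k)
      = INR (S k) * c (S k) * (z * z ^ k))%C; ring.
  - change (z * C_derive h z = z * C_derive h z + - (INR 0 * c O * z ^ 0))%C.
    simpl; ring.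
Qed.

Lemma power_series_derive_n (c : nat -> C) (h : C -> C) (m : nat) :
  has_power_series c h ->
  has_power_series
    (fun k => RtoC (INR (fact (k + m)) / INR (fact k)) * c (k + m)%nat)%C
    (C_derive_n m h).
Proof.
  intros H; induction m as [|m IH].
  - apply has_power_series_ext with (2 := H); intros k.
    rewrite Nat.add_0_r; unfold Rdiv; rewrite Rinv_r by apply INR_fact_neq_0.
    ring.
  - apply has_power_series_ext with (2 := power_series_derive _ _ IH).
    intros k; replace (k + S m)%nat with (S k + m)%nat by lia.
    rewrite Cmult_assoc, <- RtoC_mult; f_equal; f_equal.
    (* The new factor [k + 1] cancels against [(k + 1)! = (k + 1) k!]. *)
    rewrite (fact_simpl k), mult_INR; field; split;
      [apply INR_fact_neq_0|apply not_0_INR; lia].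
Qed.

Lemma power_series_Dop (p m : nat) (c : nat -> C) (h : C -> C) :
  (m < p)%nat -> has_power_series c h ->
  has_power_series (fun k => RtoC (INR k / INR (p - m)) * c k)%C (Dop p m h).
Proof.
  intros hmp H z hz.
  assert (hq : INR (p - m) <> 0) by (apply not_0_INR; lia).
  eapply Cseries_eq; [| |exact (is_series_scal_l (/ RtoC (INR (p - m)))%C _ _
    (power_series_euler c h H z hz))].
  - intros k; rewrite RtoC_div by exact hq.
    change (/ RtoC (INR (p - m)) * (INR k * c k * z ^ k)
      = INR k / INR (p - m) * c k * z ^ k)%C; unfold Cdiv; ring.
  - unfold Dop.
    change (/ RtoC (INR (p - m)) * (z * C_derive h z)
      = z / INR (p - m) * C_derive h z)%C; unfold Cdiv; ring.
Qed.

Lemma power_series_salagean (p m Omega : nat) (c : nat -> C) (f : C -> C) :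
  (m < p)%nat -> has_power_series c f ->
  has_power_series
    (fun k => RtoC ((INR k / INR (p - m)) ^ Omega
                    * (INR (fact (k + m)) / INR (fact k))) * c (k + m)%nat)%C
    (salagean p m Omega f).
Proof.
  intros hmp H; induction Omega as [|Omega IH].
  - apply has_power_series_ext with (2 := power_series_derive_n _ _ m H).
    intros k; simpl; now rewrite Rmult_1_l.
  - apply has_power_series_ext with (2 := power_series_Dop p m _ _ hmp IH).
    intros k; rewrite Cmult_assoc, <- RtoC_mult; f_equal; f_equal; simpl; ring.
Qed.

(** Writing S for [salagean p m Omega f], the function is the combination (1 - lambda) S + lambda D
    S with D the operator [Dop p m], whose action on coefficients is diagonal. *)
Lemma power_series_calF (p m Omega : nat) (lambda : R) (c : nat -> C)
    (f : C -> C) :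
  (m < p)%nat -> has_power_series c f ->
  has_power_series
    (fun k => RtoC ((1 - lambda + lambda * (INR k / INR (p - m)))
                    * ((INR k / INR (p - m)) ^ Omega
                       * (INR (fact (k + m)) / INR (fact k))))
              * c (k + m)%nat)%C
    (calF p lambda m Omega f).
Proof.
  intros hmp H.
  pose proof (power_series_salagean p m Omega c f hmp H) as HS.
  pose proof (power_series_scal_plus (1 - lambda)%C lambda _ _ _ _ HS
    (power_series_Dop p m _ _ hmp HS)) as HF.
  intros z hz; eapply Cseries_eq; [| |exact (HF z hz)].
  - intros k; rewrite !RtoC_mult, RtoC_plus, RtoC_minus, !RtoC_mult; ring.
  - unfold calF, Dop, Cdiv; ring.
Qed.

(** * Series of the quotient by a power of z *)

Lemma div_pow_series (c : nat -> C) (h : C -> C) (q : nat) (z : C) :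
  has_power_series c h -> (forall k, (k < q)%nat -> c k = 0) ->
  in_disk z -> z <> 0 ->
  is_Cseries (fun j => c (q + j)%nat * z ^ j)%C (div_pow h q z).
Proof.
  intros H hc hz hz0; unfold div_pow.
  destruct (Ceq_dec z 0) as [e|_]; [contradiction|].
  assert (hzq : (z ^ q)%C <> 0) by now apply Cpow_nz.
  assert (Hq : is_Cseries (fun j => c (q + j)%nat * z ^ (q + j))%C (h z)).
  (* [is_series_incr_n] drops a positive number of terms, so [q = 0] is treated apart. *)
  { destruct (Nat.eq_dec q 0) as [->|hq]; [exact (H z hz)|].
    apply (is_series_incr_n (fun k => c k * z ^ k)%C q); [lia|].
    rewrite (sum_n_ext_loc _ (fun _ => zero)).
    - unfold sum_n; rewrite sum_n_m_const_zero, plus_zero_r; exact (H z hz).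
    - intros k hk; rewrite hc by lia; apply Cmult_0_l. }
  eapply Cseries_eq; [| |exact (is_series_scal_l (/ z ^ q)%C _ _ Hq)].
  - intros j.
    change (/ z ^ q * (c (q + j)%nat * z ^ (q + j)) = c (q + j)%nat * z ^ j)%C.
    rewrite Cpow_add_r; field; exact hzq.
  - change (/ z ^ q * h z = h z / z ^ q)%C; unfold Cdiv; ring.
Qed.

(** Index [j] of the quotient is index [j + p - m] of [calF], hence [j + p] of [f]. The outer
    derivative raises the exponent of [j + p - m] to [Omega + 1], and 1 - lambda + lambda (j + p -
    m) / (p - m) simplifies to 1 + lambda j / (p - m). *)
Lemma calF_derive_quotient_series (p m Omega : nat) (lambda : R)
    (c : nat -> C) (f : C -> C) (z : C) :
  (m < p)%nat -> has_power_series c f ->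
  (forall k, (k < p)%nat -> c k = 0) -> in_disk z -> z <> 0 ->
  is_Cseries (fun j => coefF p lambda m Omega j * c (j + p)%nat * z ^ j)%C
    (div_pow (C_derive (calF p lambda m Omega f)) (p - m - 1) z).
Proof.
  intros hmp H hc hz hz0.
  eapply Cseries_eq; [|reflexivity|apply div_pow_series with
    (1 := power_series_derive _ _ (power_series_calF p m Omega lambda c f hmp H));
    try assumption].
  - intros j; cbv beta; f_equal.
    replace (S (p - m - 1 + j))%nat with (j + p - m)%nat by lia.
    replace (j + p - m + m)%nat with (j + p)%nat by lia.
    rewrite Cmult_assoc, <- RtoC_mult; f_equal; f_equal.
    assert (hq : INR (p - m) <> 0) by (apply not_0_INR; lia).
    unfold coefF, Rdiv.
    rewrite Rpow_mult_distr, pow_inv, pow_add, pow_1.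
    replace (INR (j + p - m)) with (INR j + INR (p - m))
      by (rewrite <- plus_INR; f_equal; lia).
    field; repeat split;
      [apply INR_fact_neq_0|now apply pow_nonzero|exact hq].
  (* For [k < p - m - 1] the coefficient of the derivative involves [c (S k + m)], whose index is
     below [p]. *)
  - intros k hk; cbv beta.
    rewrite (hc (S k + m)%nat) by lia; now rewrite !Cmult_0_r.
Qed.

(** * From the expansion past z^p to a full power series *)

Lemma sum_n_single {G : AbelianMonoid} (a : nat -> G) (p M : nat) :
  (p <= M)%nat -> (forall k, (k <= M)%nat -> k <> p -> a k = zero) ->
  sum_n a M = a p.
Proof.
  induction M as [|M IH]; intros hp ha.
  - replace p with 0%nat by lia; apply sum_O.
  - rewrite sum_Sn; destruct (Nat.eq_dec p (S M)) as [->|hne].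
    + rewrite (sum_n_ext_loc _ (fun _ => zero)) by (intros; apply ha; lia).
      unfold sum_n; now rewrite sum_n_m_const_zero, plus_zero_l.
    + rewrite (ha (S M)), plus_zero_r by lia.
      apply IH; [lia|intros; apply ha; lia].
Qed.

(** The entries of [a] below [n + p] are arbitrary; they are overwritten here by the true Taylor
    coefficients, so that the results on power series starting at index 0 apply. *)
Definition full_coef (n p : nat) (a : nat -> C) (k : nat) : C :=
  if (k =? p)%nat then 1 else if (n + p <=? k)%nat then a k else 0.

Lemma full_coef_lead (n p : nat) (a : nat -> C) : full_coef n p a p = 1.
Proof. unfold full_coef; now rewrite Nat.eqb_refl. Qed.

Lemma full_coef_tail (n p : nat) (a : nat -> C) (k : nat) :
  (1 <= n)%nat -> (n + p <= k)%nat -> full_coef n p a k = a k.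
Proof.
  intros hn hk; unfold full_coef.
  destruct (Nat.eqb_spec k p); [lia|].
  destruct (Nat.leb_spec (n + p) k); [reflexivity|lia].
Qed.

Lemma full_coef_gap (n p : nat) (a : nat -> C) (k : nat) :
  k <> p -> (k < n + p)%nat -> full_coef n p a k = 0.
Proof.
  intros hp hk; unfold full_coef.
  destruct (Nat.eqb_spec k p); [lia|].
  destruct (Nat.leb_spec (n + p) k); [lia|reflexivity].
Qed.

(** The terms of index below [n + p] add up to [z ^ p], exactly what [has_expansion] subtracts from
    [f z]. *)
Lemma has_expansion_power_series (n p : nat) (a : nat -> C) (f : C -> C) :
  (1 <= n)%nat -> has_expansion n p a f ->
  has_power_series (full_coef n p a) f.
Proof.
  intros hn H z hz.
  apply (@is_series_decr_n C_AbsRing C_NormedModule _ (n + p)); [lia|].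
  rewrite (sum_n_single _ p).
  - eapply Cseries_eq; [| |exact (H z hz)].
    + intros j; rewrite full_coef_tail by lia.
      now replace (n + j + p)%nat with (n + p + j)%nat by lia.
    + rewrite full_coef_lead.
      change (f z - z ^ p = f z + - (1 * z ^ p))%C; ring.
  - lia.
  - intros k hk hkp; rewrite full_coef_gap by lia; apply Cmult_0_l.
Qed.

Lemma is_series_Re (a : nat -> C) (l : C) :
  is_Cseries a l -> is_series (fun k => fst (a k)) (fst l).
Proof.
  intros H.
  assert (e : forall N, sum_n (fun k => fst (a k)) N
    = fst (@sum_n C_NormedModule a N)).
  { induction N as [|N IH]; [now rewrite !sum_O|].
    rewrite !sum_Sn, IH; reflexivity. }
  apply filterlim_ext with (1 := fun N => eq_sym (e N)).
  eapply filterlim_comp; [exact H|].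
  intros P [eps hP]; exists eps; intros y [hy _]; now apply hP.
Qed.

(** Since the terms are nonnegative, each partial sum is at most [B] for every [r < 1]. A partial
    sum is a polynomial in [r], so the bound survives at [r = 1]; increasing bounded partial sums
    then converge. *)
Lemma Abel_nonneg (u : nat -> R) (n : nat) (B : R) :
  (forall j, 0 <= u j) ->
  (forall r, 0 < r < 1 ->
     exists l, l <= B /\ is_series (fun j => u j * r ^ (n + j)) l) ->
  ex_series u /\ Series u <= B.
Proof.
  intros hu H.
  assert (hpart : forall r N, 0 < r < 1 ->
    sum_n (fun j => u j * r ^ (n + j)) N <= B).
  { intros r N hr; destruct (H r hr) as [l [hl hs]].
    eapply Rle_trans; [|exact hl].
    apply (is_lim_seq_incr_compare
      (fun M => sum_n (fun j => u j * r ^ (n + j)) M)); [exact hs|].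
    intros k; rewrite sum_Sn; unfold plus; simpl.
    assert (0 <= u (S k) * r ^ (n + S k)); [|lra].
    apply Rmult_le_pos; [apply hu|apply pow_le; lra]. }
  assert (hbound : forall N, sum_n u N <= B).
  { intros N.
    assert (hcont : continuous
      (fun r => sum_n (fun j => u j * r ^ (n + j)) N) 1).
    { apply (ex_derive_continuous (V := R_NormedModule)).
      apply (ex_derive_sum_n (V := R_NormedModule)
        (fun j r => u j * r ^ (n + j)) N 1).
      intros k _; auto_derive; exact I. }
    apply (@filterlim_le R (at_left 1) _
      (fun r => sum_n (fun j => u j * r ^ (n + j)) N) (fun _ => B)
      (sum_n u N) B).
    (* Radius 1 around 1, restricted to [r < 1], keeps [r] inside the interval (0, 1). *)
    - exists (mkposreal 1 Rlt_0_1); intros r hr hr1; apply hpart.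
      change (Rabs (r - 1) < 1) in hr; apply Rabs_def2 in hr; lra.
    - rewrite <- (sum_n_ext (fun j => u j * 1 ^ (n + j)) u)
        by (intros j; rewrite pow1; apply Rmult_1_r).
      eapply filterlim_filter_le_1; [apply filter_le_within|exact hcont].
    - apply filterlim_const. }
  assert (hex : ex_finite_lim_seq (sum_n u)).
  { apply ex_finite_lim_seq_incr with B; [|exact hbound].
    intros k; rewrite sum_Sn; unfold plus; simpl; pose proof (hu (S k)); lra. }
  assert (hser : ex_series u) by exact hex.
  split; [exact hser|].
  apply (@filterlim_le nat eventually _ (sum_n u) (fun _ => B) (Series u) B).
  - apply filter_forall; exact hbound.
  - exact (Series_correct u hser).
  - apply filterlim_const.
Qed.

(** * The weights [coefF] and rotations of the argument *)

Lemma coefF_nonneg (p m Omega k : nat) (lambda : R) :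
  (m < p)%nat -> 0 <= lambda -> 0 <= coefF p lambda m Omega k.
Proof.
  intros hmp hl; unfold coefF.
  assert (hq : 0 < INR (p - m)) by (apply lt_0_INR; lia).
  apply Rdiv_le_0_compat.
  - repeat apply Rmult_le_pos; [apply pow_le, pos_INR|apply pos_INR|].
    apply Rplus_le_le_0_compat; [lra|].
    apply Rdiv_le_0_compat; [|exact hq].
    apply Rmult_le_pos; [exact hl|apply pos_INR].
  - apply Rmult_lt_0_compat; [now apply pow_lt|apply INR_fact_lt_0].
Qed.

(** The surplus factor [p - m] cancels against (p - m)! = (p - m) (p - m - 1)!. *)
Lemma coefF_0 (p m Omega : nat) (lambda : R) :
  (m < p)%nat ->
  coefF p lambda m Omega 0 = INR (fact p) / INR (fact (p - m - 1)).
Proof.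
  intros hmp; unfold coefF.
  rewrite !Nat.add_0_l; replace (p - m)%nat with (S (p - m - 1)) by lia.
  replace (S (p - m - 1) - 1)%nat with (p - m - 1)%nat by lia.
  rewrite fact_simpl, mult_INR, pow_add, pow_1; simpl (INR 0).
  assert (hq : INR (S (p - m - 1)) <> 0) by (apply not_0_INR; lia).
  field; repeat split;
    [apply INR_fact_neq_0|exact hq|now apply pow_nonzero].
Qed.

Lemma expi_add (s t : R) : (expi s * expi t)%C = expi (s + t).
Proof.
  unfold expi, Cmult; simpl.
  rewrite cos_plus, sin_plus; f_equal; ring.
Qed.

Lemma expi_pow (t : R) (k : nat) : (expi t ^ k)%C = expi (INR k * t).
Proof.
  induction k as [|k IH].
  - simpl; unfold expi; now rewrite Rmult_0_l, cos_0, sin_0.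
  - rewrite Cpow_S, IH, expi_add, S_INR; f_equal; ring.
Qed.

Lemma Cmod_expi (t : R) : Cmod (expi t) = 1.
Proof.
  unfold Cmod, expi; simpl fst; simpl snd.
  rewrite <- !Rsqr_pow2, Rplus_comm, sin2_cos2; apply sqrt_1.
Qed.

Lemma has_arg_rotate (w : C) (k : nat) (r t : R) :
  has_arg w (INR k * t) ->
  (w * (r * expi (- t)) ^ k)%C = RtoC (Cmod w * r ^ k).
Proof.
  intros hw; rewrite Cpow_mult_l, expi_pow, <- RtoC_pow, RtoC_mult.
  (* Naming the modulus first keeps the rewriting of [w] from also reaching inside [Cmod w]. *)
  set (c := RtoC (Cmod w)) in *.
  unfold has_arg in hw; fold c in hw; rewrite hw.
  replace (c * expi (INR k * t) * (RtoC (r ^ k) * expi (INR k * - t)))%C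
    with (c * RtoC (r ^ k) * (expi (INR k * t) * expi (INR k * - t)))%C by ring.
  rewrite expi_add; replace (INR k * t + INR k * - t) with 0 by ring.
  unfold expi at 1; rewrite cos_0, sin_0.
  change (c * RtoC (r ^ k) * 1 = c * RtoC (r ^ k))%C; ring.
Qed.

(** * The coefficient inequality *)

Theorem theorem2p6 (n p m Omega : nat) (lambda alpha beta delta phi : R)
    (a b : nat -> C) (f g : C -> C)
    (hn : (1 <= n)%nat) (hp : (1 <= p)%nat) (hmp : (m < p)%nat)
    (hlambda : 0 <= lambda <= 1)
    (hf : class_F n p lambda m Omega a f)
    (hg : class_F n p lambda m Omega b g)
    (hN : in_nbhd alpha beta lambda m delta Omega p g f)
    (halpha : 0 <= alpha) (hab : alpha < beta) (hbeta : beta <= PI)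
    (harg : forall k : nat, (n <= k)%nat ->
       has_arg (expi alpha * a (k + p)%nat - expi beta * b (k + p)%nat)%C
               (INR k * phi)) :
  let u := fun k : nat =>
    coefF p lambda m Omega k
    * Cmod (expi alpha * a (k + p)%nat - expi beta * b (k + p)%nat)%C in
  ex_series (fun j : nat => u (n + j)%nat) /\
  Series (fun j : nat => u (n + j)%nat)
  <= delta - INR (fact p) / INR (fact (p - m - 1)) * (cos alpha - cos beta).
Proof.
  intros u.
  apply Abel_nonneg with n.
  { intros j; apply Rmult_le_pos; [|apply Cmod_ge_0].
    apply coefF_nonneg; [exact hmp|apply hlambda]. }
  intros r hr.
  set (z := (r * expi (- phi))%C).
  assert (hmod : Cmod z = r).
  { unfold z; rewrite Cmod_mult, Cmod_expi, Cmod_R, Rabs_pos_eq; lra. }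
  assert (hz : in_disk z) by (unfold in_disk; lra).
  assert (hz0 : z <> 0) by (apply Cmod_gt_0; lra).
  destruct hf as [hf _], hg as [hg _], hN as (_ & _ & hN).
  specialize (hN z hz).
  assert (hlow : forall c k, (k < p)%nat -> full_coef n p c k = 0)
    by (intros; apply full_coef_gap; lia).
  pose proof (calF_derive_quotient_series p m Omega lambda _ f z hmp
    (has_expansion_power_series n p a f hn hf) (hlow a) hz hz0) as Hf.
  pose proof (calF_derive_quotient_series p m Omega lambda _ g z hmp
    (has_expansion_power_series n p b g hn hg) (hlow b) hz hz0) as Hg.
  set (Vf := div_pow (C_derive (calF p lambda m Omega f)) (p - m - 1) z) in *.
  set (Vg := div_pow (C_derive (calF p lambda m Omega g)) (p - m - 1) z) in *.
  (* Both leading coefficients are 1, so [W 0] is e^(i alpha) - e^(i beta); [W j] vanishes for 0 < j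
     < n. *)
  set (W := fun j => (expi alpha * full_coef n p a (j + p)
                      - expi beta * full_coef n p b (j + p))%C).
  assert (HW : is_Cseries (fun j => coefF p lambda m Omega j * (W j * z ^ j))%C
    (expi alpha * Vf - expi beta * Vg)%C).
  { eapply Cseries_eq; [|reflexivity|exact (is_series_minus _ _ _ _
      (is_series_scal_l (expi alpha) _ _ Hf)
      (is_series_scal_l (expi beta) _ _ Hg))].
    intros j; unfold W.
    change (expi alpha * (coefF p lambda m Omega j * full_coef n p a (j + p) * z ^ j)
      + - (expi beta * (coefF p lambda m Omega j * full_coef n p b (j + p) * z ^ j))
      = coefF p lambda m Omega j * ((expi alpha * full_coef n p a (j + p)
          - expi beta * full_coef n p b (j + p)) * z ^ j))%C.
    ring. }
  apply is_series_Re in HW.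
  (* The witness is the real part of the whole difference minus that of its constant term, where cos
     alpha - cos beta is the real part of [W 0]. *)
  exists (fst (expi alpha * Vf - expi beta * Vg)%C
    - INR (fact p) / INR (fact (p - m - 1)) * (cos alpha - cos beta)).
  split.
  { pose proof (re_le_Cmod (expi alpha * Vf - expi beta * Vg)%C) as hre.
    pose proof (Rle_abs (Re (expi alpha * Vf - expi beta * Vg)%C)) as habs.
    change (fst (expi alpha * Vf - expi beta * Vg)%C)
      with (Re (expi alpha * Vf - expi beta * Vg)%C); lra. }
  apply is_series_ext with
    (fun j => fst (coefF p lambda m Omega (n + j) * (W (n + j)%nat * z ^ (n + j)))%C).
  (* From index [n] on, the argument condition makes each term real, so taking real parts loses
     nothing. *)
  { intros j; unfold W; rewrite !full_coef_tail by lia.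
    unfold z; rewrite (has_arg_rotate _ (n + j) r phi) by (apply harg; lia).
    rewrite <- RtoC_mult; unfold RtoC, fst, u.
    symmetry; apply Rmult_assoc. }
  apply (is_series_incr_n (fun j =>
    fst (coefF p lambda m Omega j * (W j * z ^ j))%C) n); [lia|].
  (* Of the [n] leading terms only the constant one is nonzero. *)
  rewrite (sum_n_single _ 0%nat).
  - replace (plus _ _) with (fst (expi alpha * Vf - expi beta * Vg)%C);
      [exact HW|].
    unfold W; simpl (0 + p)%nat; rewrite !full_coef_lead, coefF_0 by exact hmp.
    unfold plus; simpl; ring.
  - lia.
  - intros k hk hk0; unfold W; rewrite !full_coef_gap by lia.
    rewrite !Cmult_0_r; replace ((0 - 0) * z ^ k)%C with (RtoC 0) by ring.
    now rewrite Cmult_0_r.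
Qed.
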